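(* Let $m$ be a compactly supported Borel probability measure on $\mathbb{R}$, $\mathfrak{H}_0=L^2(\mathbb{R};m)$, $\mathfrak{H}_1=\mathbb{C}$. Let $A_0$ be the operator of multiplication by the independent variable on $\mathfrak{H}_0$, let $A_1$ be multiplication by a real number $a_1$ on $\mathfrak{H}_1$, and let $v\in\mathfrak{H}_0$ be a cyclic vector for $A_0$. Let $V:\mathfrak{H}_1\to\mathfrak{H}_0$ be given by $Vc=cv$, so that $V^*x_0=\langle v,x_0\rangle_{\mathfrak{H}_0}$. Let $\lambda\in S_{\mathrm{s}}$. Then the operator $X_\lambda$ is a strong solution to the Riccati equation $$A_1X-XA_0-XVX+V^*=0.$$ Moreover, if $\lambda\in S_{\mathrm{pp}}$, the solution $X_\lambda$ is bounded, and if $\lambda\in S_{\mathrm{sc}}=S_{\mathrm{s}}\setminus S_{\mathrm{pp}}$, the operator $X_\lambda$ is non-closable.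
   Context: Inner products are linear in the second argument. A vector $v$ is cyclic for $A_0$ if the closed linear span of $\{A_0^nv:n\ge0\}$ is $\mathfrak{H}_0$. Notation: $\int\frac{f(\mu)\,dm(\mu)}{\mu-\lambda-\mathrm{i}0}:=\lim_{\varepsilon\to+0}\int\frac{f(\mu)\,dm(\mu)}{\mu-\lambda-\mathrm{i}\varepsilon}$; an equation involving this expression includes the requirement that the limit exists finitely. In $\int |v(\mu)|^2|\mu-\lambda|^{-2}dm(\mu)$ the factor $|\mu-\lambda|^{-2}$ equals $+\infty$ at $\mu=\lambda$ (with $0\cdot\infty=0$). $$S_{\mathrm{s}}=\Big\{\lambda\in\mathbb{R}: a_1-\lambda=\int\frac{|v(\mu)|^2dm(\mu)}{\mu-\lambda-\mathrm{i}0}\Big\},$$ $$S_{\mathrm{pp}}=\Big\{\lambda\in\mathbb{R}: a_1-\lambda=\int\frac{|v(\mu)|^2dm(\mu)}{\mu-\lambda},\ \int\frac{|v(\mu)|^2dm(\mu)}{|\mu-\lambda|^2}<\infty\Big\}.$$ For $\lambda\in\mathbb{R}$, $X_\lambda$ is the linear operator (functional) from $L^2(\mathbb{R};m)$ to $\mathbb{C}$ with domain $$\operatorname{Dom}(X_\lambda)=\Big\{\varphi\in L^2(\mathbb{R};m):\ \lim_{\varepsilon\to+0}\int\frac{\overline{v(\mu)}\varphi(\mu)}{\mu-\lambda-\mathrm{i}\varepsilon}dm(\mu)\ \text{exists finitely}\Big\}$$ and action $X_\lambda\varphi=\lim_{\varepsilon\to+0}\int\frac{\overline{v(\mu)}\varphi(\mu)}{\mu-\lambda-\mathrm{i}\varepsilon}dm(\mu)$.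 A densely defined (possibly unbounded, not necessarily closable) operator $X$ from $\mathfrak{H}_0$ to $\mathfrak{H}_1$ is a strong solution to the Riccati equation $A_1X-XA_0-XVX+V^*=0$ if $(A_0+VX)x\in\operatorname{Dom}(X)$ and $A_1Xx-X(A_0+VX)x+V^*x=0$ for every $x\in\operatorname{Dom}(X)$. *)

(* Defs.v *)
From HB Require Import structures.
From mathcomp Require Import all_boot all_order all_algebra.
From mathcomp Require Import generic_quotient ring_quotient complex.
From mathcomp Require Import all_classical all_reals all_analysis.
From mathcomp Require Import measurable_realfun.

Set Implicit Arguments.
Unset Strict Implicit.
Unset Printing Implicit Defensive.

Import Order.TTheory GRing.Theory Num.Theory.
Import numFieldNormedType.Exports.

Local Open Scope classical_set_scope.
Local Open Scope ring_scope.
Local Open Scope complex_scope.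

Lemma normc_ge0 (R : rcfType) (z : R[i]) : 0 <= Normc.normc z.
Proof. by case: z => x y; exact: sqrtr_ge0. Qed.

Section complex_functions.
Context d (T : measurableType d) (R : realType).
Implicit Types f g : T -> R[i].

Definition cmeasurable f :=
  measurable_fun setT (fun x => complex.Re (f x)) /\
  measurable_fun setT (fun x => complex.Im (f x)).

Definition cmodulus f : T -> R := fun x => Normc.normc (f x).

Variable m : {measure set T -> \bar R}.

(* Both parts are the total integral of the library, so this is the Lebesgue
   integral whenever f is integrable. *)
Definition cintegral f : R[i] :=
  (\int[m]_x complex.Re (f x)) +i* (\int[m]_x complex.Im (f x)).

Lemma measurable_cmodulus f : cmeasurable f -> measurable_fun setT (cmodulus f).
Proof.
move=> [mr mi].
have -> : cmodulus f = fun x =>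
    Num.sqrt (complex.Re (f x) ^+ 2 + complex.Im (f x) ^+ 2).
  by apply/funext => x; rewrite /cmodulus; case: (f x).
have ms : measurable_fun setT (@Num.sqrt R).
  by apply: continuous_measurable_fun; exact: sqrt_continuous.
apply: (measurableT_comp ms).
by apply: measurable_funD; exact: measurable_funX.
Qed.

Lemma cmeasurable0 : cmeasurable (fun=> 0).
Proof. by split; exact: measurable_cst. Qed.

Lemma cmeasurableD f g :
  cmeasurable f -> cmeasurable g -> cmeasurable (fun x => f x + g x).
Proof.
move=> [fr fi] [gr gi]; split.
  rewrite [X in measurable_fun _ X](_ : _ =
    fun x => complex.Re (f x) + complex.Re (g x)); last first.
    by apply/funext => x; case: (f x) => ? ?; case: (g x).
  exact: measurable_funD.
rewrite [X in measurable_fun _ X](_ : _ =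
  fun x => complex.Im (f x) + complex.Im (g x)); last first.
  by apply/funext => x; case: (f x) => ? ?; case: (g x).
exact: measurable_funD.
Qed.

Lemma cmeasurableM f g :
  cmeasurable f -> cmeasurable g -> cmeasurable (fun x => f x * g x).
Proof.
move=> [fr fi] [gr gi]; split.
  rewrite [X in measurable_fun _ X](_ : _ =
    fun x => complex.Re (f x) * complex.Re (g x)
             - complex.Im (f x) * complex.Im (g x)); last first.
    by apply/funext => x; case: (f x) => ? ?; case: (g x).
  by apply: measurable_funB; exact: measurable_funM.
rewrite [X in measurable_fun _ X](_ : _ =
  fun x => complex.Re (f x) * complex.Im (g x)
           + complex.Im (f x) * complex.Re (g x)); last first.
  by apply/funext => x; case: (f x) => ? ?; case: (g x).
by apply: measurable_funD; exact: measurable_funM.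
Qed.

Lemma cmeasurable_cst (a : R[i]) : cmeasurable (fun=> a).
Proof. by split; exact: measurable_cst. Qed.

Lemma cmeasurable_real (u : T -> R) :
  measurable_fun setT u -> cmeasurable (fun x => (u x)%:C).
Proof. by move=> mu; split=> //; exact: measurable_cst. Qed.

Lemma eq_ae_cintegral f g : cmeasurable f -> cmeasurable g ->
  {ae m, forall x, f x = g x} -> cintegral f = cintegral g.
Proof.
move=> [fr fi] [gr gi] fg; rewrite /cintegral /Rintegral.
congr (fine _ +i* fine _); apply: ae_eq_integral => //;
  by [apply/measurable_EFinP|apply: filterS fg => x -> _].
Qed.

Lemma cintegralZl (c : R[i]) f :
  m.-integrable setT (EFin \o (fun x => complex.Re (f x))) ->
  m.-integrable setT (EFin \o (fun x => complex.Im (f x))) ->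
  cintegral (fun x => c * f x) = c * cintegral f.
Proof.
case: c => a b fr fi; rewrite /cintegral.
have int (h : T -> R) r : m.-integrable setT (EFin \o h) ->
    m.-integrable setT (EFin \o (fun x => r * h x)).
  by move=> ih; exact: (integrableZl measurableT r ih).
transitivity ((a * (\int[m]_x complex.Re (f x))
               - b * (\int[m]_x complex.Im (f x))) +i*
  (a * (\int[m]_x complex.Im (f x)) + b * (\int[m]_x complex.Re (f x)))).
  rewrite -!RintegralZl// -RintegralB ?int// -RintegralD ?int//.
  by congr (_ +i* _); apply: eq_Rintegral => x _; case: (f x).
by [].
Qed.

End complex_functions.

Section square_integrable.
Context d (T : measurableType d) (R : realType).
Variable m : {measure set T -> \bar R}.
Implicit Types f g : T -> R[i]^o.

Definition sqint : {pred T -> R[i]^o} :=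
  mem [set f | cmeasurable f /\ finite_norm m 2%:E (cmodulus f)].

Lemma sqintP f :
  reflect (cmeasurable f /\ finite_norm m 2%:E (cmodulus f)) (f \in sqint).
Proof. by apply: (iffP idP); rewrite inE. Qed.

Lemma cmodulus_Lfun f : f \in sqint -> cmodulus f \in Lfun m 2%:E.
Proof.
move=> /sqintP[mf ff]; rewrite inE; apply/andP; split; rewrite inE//=.
exact: measurable_cmodulus.
Qed.

Lemma LnormZ_cmodulus f (a : R[i]) : f \in sqint ->
  ('N[m]_2%:E [EFin \o cmodulus (fun x => (a * f x)%R)] =
   (Normc.normc a)%:E * 'N[m]_2%:E [EFin \o cmodulus f])%E.
Proof.
move=> /cmodulus_Lfun ff.
have := LnormZ (Lfun_Sub (lee1n 2) ff) (Normc.normc a).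
rewrite /= ger0_norm => [<-|]; last exact: normc_ge0.
by apply: eq_Lnorm => x /=; rewrite /cmodulus Normc.normcM.
Qed.

Lemma ler_Lnorm_cmodulusD f g : f \in sqint -> g \in sqint ->
  ('N[m]_2%:E [EFin \o cmodulus (fun x => (f x + g x)%R)] <=
   'N[m]_2%:E [EFin \o cmodulus f] + 'N[m]_2%:E [EFin \o cmodulus g])%E.
Proof.
move=> /sqintP[mf ff] /sqintP[mg fg].
have mf' := measurable_cmodulus mf; have mg' := measurable_cmodulus mg.
have mfg := measurable_cmodulus (cmeasurableD mf mg).
apply: le_trans (minkowski_EFin m mf' mg' (ler1n _ 2)).
rewrite unlock; apply: gt0_ler_poweR; rewrite ?invr_ge0 ?ler0n//.
- by rewrite in_itv/= leey andbT; apply: integral_ge0 => x _; rewrite lee_fin powR_ge0.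
- by rewrite in_itv/= leey andbT; apply: integral_ge0 => x _; rewrite lee_fin powR_ge0.
have mp (h : T -> R) : measurable_fun setT h ->
    measurable_fun setT (fun x => (`|(h x)%:E| `^ 2)%E).
  move=> mh; under eq_fun do rewrite abse_EFin poweR_EFin.
  apply/measurable_EFinP.
  apply: (measurableT_comp (measurable_powR _)).
  exact: measurableT_comp.
apply: ge0_le_integral => //=.
- exact: mp.
- by apply: mp; exact: measurable_funD.
- move=> x _; rewrite lee_fin ge0_ler_powR ?nnegrE//.
  rewrite !ger0_norm ?addr_ge0 /cmodulus ?normc_ge0//.
  exact: le_normcD.
Qed.

Lemma sqint_submod_closed : submod_closed sqint.
Proof.
split.
  apply/sqintP; split; first exact: cmeasurable0.
  rewrite /finite_norm (_ : cmodulus _ = cst 0); last first.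
    by apply/funext => x; exact: Normc.normc0.
  by rewrite [X in 'N[_]__[X]%E](_ : _ = cst 0%E)// Lnorm0// eqe pnatr_eq0.
move=> a f g fP gP; have /sqintP[mf ff] := fP; have /sqintP[mg fg] := gP.
have afP : (a *: f : T -> R[i]^o) \in sqint.
  apply/sqintP; split.
    exact: (cmeasurableM (cmeasurable_cst _ a) mf).
  by rewrite /finite_norm LnormZ_cmodulus// lte_mul_pinfty// lee_fin normc_ge0.
apply/sqintP; split.
  by have /sqintP[maf _] := afP; exact: cmeasurableD.
apply: le_lt_trans (ler_Lnorm_cmodulusD afP gP) _.
by have /sqintP[_ faf] := afP; rewrite lte_add_pinfty.
Qed.

HB.instance Definition _ := GRing.isSubmodClosed.Build _ _ sqint
  sqint_submod_closed.

Record sqintType := SqInt {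
  sqint_fun :> T -> R[i]^o ;
  sqint_funP : sqint_fun \in sqint }.

HB.instance Definition _ := [isSub for sqint_fun].
HB.instance Definition _ := [Choice of sqintType by <:].
HB.instance Definition _ := [SubChoice_isSubLmodule of sqintType by <:].

Definition ae_null : {pred sqintType} :=
  mem [set f : sqintType | {ae m, forall x, f x = 0}].

Lemma ae_nullP (f : sqintType) :
  reflect {ae m, forall x, f x = 0} (f \in ae_null).
Proof. by apply: (iffP idP); rewrite inE. Qed.

Lemma ae_null_zmod_closed : zmod_closed ae_null.
Proof.
split; first by apply/ae_nullP; exact/nearW.
move=> f g /ae_nullP f0 /ae_nullP g0; apply/ae_nullP.
by apply: filterS2 f0 g0 => x fx gx; rewrite /= [LHS]/(f x - g x) fx gx; exact: (subr0 (0 : R[i])).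
Qed.

HB.instance Definition _ := GRing.isZmodClosed.Build _ ae_null
  ae_null_zmod_closed.

Definition L2 : Type := Quotient.quot ae_null.
HB.instance Definition _ := GRing.Zmodule.on L2.
HB.instance Definition _ := EqQuotient.on L2.

(* An element of L2 is applied to a point through a chosen representative. *)
Definition L2_fun (u : L2) : T -> R[i] := repr u.

End square_integrable.
Arguments L2 {d T R} m.
Coercion L2_fun : L2 >-> Funclass.

Section L2_space.
Context d (T : measurableType d) (R : realType).
Variable m : {measure set T -> \bar R}.
Implicit Types (u v : L2 m) (f g : sqintType m).

Local Open Scope quotient_scope.

Lemma L2_fun_sqint u : (u : T -> R[i]^o) \in sqint m.
Proof. exact: valP. Qed.

Lemma pi_L2P f g :
  {ae m, forall x, f x = g x} <-> \pi_(L2 m) f = \pi_(L2 m) g.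
Proof.
split=> [fg|/eqP].
  apply/eqP; rewrite -Quotient.idealrBE; apply/ae_nullP.
  by apply: filterS fg => x fgx; rewrite [LHS]/(f x - g x) fgx; exact: subrr.
rewrite -Quotient.idealrBE => /ae_nullP.
by apply: filterS => x; exact: subr0_eq.
Qed.

Lemma L2_fun_pi f : {ae m, forall x, (\pi_(L2 m) f : L2 m) x = f x}.
Proof. by apply/pi_L2P; rewrite reprK. Qed.

Lemma L2_funP u v : {ae m, forall x, u x = v x} <-> u = v.
Proof. by split=> [/pi_L2P|->]; [rewrite !reprK|exact/nearW]. Qed.

Lemma L2_funD u v : {ae m, forall x, (u + v : L2 m) x = u x + v x}.
Proof.
have -> : u + v = \pi_(L2 m) (repr u + repr v) by rewrite raddfD /= !reprK.
exact: L2_fun_pi.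
Qed.

Definition L2_scale (a : R[i]) u : L2 m := \pi_(L2 m) (a *: repr u).

Lemma L2_funZ_subproof a u : {ae m, forall x, L2_scale a u x = a * u x}.
Proof. exact: L2_fun_pi. Qed.

Fact L2_scalerA a b u : L2_scale a (L2_scale b u) = L2_scale (a * b) u.
Proof.
apply/L2_funP.
apply: filterS3 (L2_funZ_subproof a (L2_scale b u)) (L2_funZ_subproof b u)
  (L2_funZ_subproof (a * b) u) => x -> -> ->.
by rewrite mulrA.
Qed.

Fact L2_scale1r u : L2_scale 1 u = u.
Proof.
by apply/L2_funP; apply: filterS (L2_funZ_subproof 1 u) => x ->; rewrite mul1r.
Qed.

Fact L2_scalerDr a u v : L2_scale a (u + v) = L2_scale a u + L2_scale a v.
Proof.
apply/L2_funP; near=> x.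
rewrite (near (L2_funZ_subproof a (u + v)) x)//.
rewrite (near (L2_funD u v) x)// (near (L2_funD (L2_scale a u) _) x)//.
rewrite (near (L2_funZ_subproof a u) x)// (near (L2_funZ_subproof a v) x)//.
exact: mulrDr.
Unshelve. all: by end_near. Qed.

Fact L2_scalerDl u a b : L2_scale (a + b) u = L2_scale a u + L2_scale b u.
Proof.
apply/L2_funP; near=> x.
rewrite (near (L2_funZ_subproof (a + b) u) x)//.
rewrite (near (L2_funD (L2_scale a u) (L2_scale b u)) x)//.
rewrite (near (L2_funZ_subproof a u) x)// (near (L2_funZ_subproof b u) x)//.
exact: mulrDl.
Unshelve. all: by end_near. Qed.

HB.instance Definition _ := GRing.Zmodule_isLmodule.Build R[i] (L2 m)
  L2_scalerA L2_scale1r L2_scalerDr L2_scalerDl.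

Lemma L2_funZ a u : {ae m, forall x, (a *: u : L2 m) x = a * u x}.
Proof. exact: L2_funZ_subproof. Qed.

Lemma L2_fun0 : {ae m, forall x, (0 : L2 m) x = 0}.
Proof.
have := L2_funZ 0 0; rewrite scale0r.
by apply: filterS => x ->; rewrite mul0r.
Qed.

Definition L2_rnorm u : R := fine ('N[m]_2%:E [EFin \o cmodulus u])%E.

Lemma L2_rnormE u : (L2_rnorm u)%:E = ('N[m]_2%:E [EFin \o cmodulus u])%E.
Proof.
have /sqintP[_ fu] := L2_fun_sqint u.
rewrite fineK// fin_numElt (lt_le_trans ltNy0) ?Lnorm_ge0//=; exact: fu.
Qed.

Lemma eq_ae_cLnorm (f g : T -> R[i]) : cmeasurable f -> cmeasurable g ->
  {ae m, forall x, f x = g x} ->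
  ('N[m]_2%:E [EFin \o cmodulus f] = 'N[m]_2%:E [EFin \o cmodulus g])%E.
Proof.
move=> /measurable_cmodulus mf /measurable_cmodulus mg fg.
rewrite unlock; congr (_ `^ _)%E.
have mp (h : T -> R) : measurable_fun setT h ->
    measurable_fun setT (fun x => (`|(h x)%:E| `^ 2)%E).
  move=> mh; under eq_fun do rewrite abse_EFin poweR_EFin.
  apply/measurable_EFinP.
  apply: (measurableT_comp (measurable_powR _)).
  exact: measurableT_comp.
apply: ge0_ae_eq_integral => //; [exact: mp|exact: mp|..].
- by move=> x _; exact: poweR_ge0.
- by move=> x _; exact: poweR_ge0.
by apply: filterS fg => x + _; rewrite /= /cmodulus => ->.
Qed.

Lemma le_ae_cLnorm (f g : T -> R[i]) : cmeasurable f -> cmeasurable g ->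
  {ae m, forall x, cmodulus f x <= cmodulus g x} ->
  ('N[m]_2%:E [EFin \o cmodulus f] <= 'N[m]_2%:E [EFin \o cmodulus g])%E.
Proof.
move=> /measurable_cmodulus mf /measurable_cmodulus mg fg.
rewrite unlock; apply: gt0_ler_poweR; rewrite ?invr_ge0 ?ler0n//.
- by rewrite in_itv/= leey andbT; apply: integral_ge0 => x _; rewrite lee_fin powR_ge0.
- by rewrite in_itv/= leey andbT; apply: integral_ge0 => x _; rewrite lee_fin powR_ge0.
have mp (h : T -> R) : measurable_fun setT h ->
    measurable_fun setT (fun x => (`|(h x)%:E| `^ 2)%E).
  move=> mh; under eq_fun do rewrite abse_EFin poweR_EFin.
  apply/measurable_EFinP.
  apply: (measurableT_comp (measurable_powR _)).
  exact: measurableT_comp.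
apply: ae_ge0_le_integral => //.
- by move=> x _; exact: poweR_ge0.
- exact: mp.
- by move=> x _; exact: poweR_ge0.
- exact: mp.
apply: filterS fg => x fgx _ /=.
rewrite lee_fin ge0_ler_powR ?nnegrE//.
by rewrite !ger0_norm ?/cmodulus ?normc_ge0.
Qed.

Definition L2_norm u : R[i] := (L2_rnorm u)%:C.

Fact L2_ler_normD u v : L2_norm (u + v) <= L2_norm u + L2_norm v.
Proof.
rewrite -rmorphD lecR -lee_fin EFinD !L2_rnormE.
have /sqintP[mu _] := L2_fun_sqint u; have /sqintP[mv _] := L2_fun_sqint v.
have /sqintP[muv _] := L2_fun_sqint (u + v).
rewrite (eq_ae_cLnorm muv (cmeasurableD mu mv) (L2_funD u v)).
by apply: ler_Lnorm_cmodulusD; exact: L2_fun_sqint.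
Qed.

Fact L2_normrZ (a : R[i]) u : L2_norm (a *: u) = `|a| * L2_norm u.
Proof.
have -> : `|a| = (Normc.normc a)%:C by [].
rewrite -rmorphM; congr (_%:C); apply: EFin_inj; rewrite EFinM !L2_rnormE.
have /sqintP[mu _] := L2_fun_sqint u; have /sqintP[mau _] := L2_fun_sqint (a *: u).
rewrite (eq_ae_cLnorm mau (cmeasurableM (cmeasurable_cst _ a) mu) (L2_funZ a u)).
by apply: LnormZ_cmodulus; exact: L2_fun_sqint.
Qed.

Fact L2_normr0_eq0 u : L2_norm u = 0 -> u = 0.
Proof.
move=> [u0]; have /sqintP[mu _] := L2_fun_sqint u.
have : ('N[m]_2%:E [EFin \o cmodulus u])%E = 0%E by rewrite -L2_rnormE u0.
move=> /Lnorm_eq0_eq0 u00; apply/L2_funP.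
have {}u00 : (EFin \o cmodulus u) = cst 0%E %[ae m].
  by apply: u00 => //; exact/measurable_EFinP/measurable_cmodulus.
apply: filterS2 u00 L2_fun0 => x /(_ I) /= [ux0] ->.
exact: Normc.eq0_normc.
Qed.

HB.instance Definition _ := Lmodule_isNormed.Build R[i] (L2 m)
  L2_ler_normD L2_normrZ L2_normr0_eq0.

Definition L2_inner u v : R[i] := cintegral m (fun x => (u x)^* * v x).

Lemma L2_inner_integrable u v :
  let f := fun x => (u x)^* * v x in
  [/\ cmeasurable f,
      m.-integrable setT (EFin \o (fun x => complex.Re (f x))) &
      m.-integrable setT (EFin \o (fun x => complex.Im (f x)))].
Proof.
move=> f; have us := L2_fun_sqint u; have vs := L2_fun_sqint v.
have /sqintP[[mru miu] _] := us; have /sqintP[mv _] := vs.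
have mf : cmeasurable f.
  apply: cmeasurableM => //; split.
    by rewrite (_ : (fun x => _) = (fun x => complex.Re (u x)))//;
      apply/funext => x; case: (u x).
  rewrite (_ : (fun x => _) = (fun x => - complex.Im (u x))).
    by apply: measurableT_comp miu.
  by apply/funext => x; case: (u x).
have fi := proj1 (Lfun1_integrable m _)
  (Lfun2_mul_Lfun1 (cmodulus_Lfun us) (cmodulus_Lfun vs)).
have fE x : Normc.normc (f x) = cmodulus u x * cmodulus v x.
  rewrite /f Normc.normcM /cmodulus; congr (_ * _).
  by case: (u x) => a b /=; rewrite sqrrN.
case: (mf) => mr mi; split=> //.
- apply: le_integrable fi => //; first exact/measurable_EFinP.
  move=> x _ /=; rewrite lee_fin -fE [leRHS]ger0_norm ?normc_ge0//.
  case: (f x) => a b /=; rewrite -sqrtr_sqr ler_wsqrtr// lerDl sqr_ge0//.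
- apply: le_integrable fi => //; first exact/measurable_EFinP.
  move=> x _ /=; rewrite lee_fin -fE [leRHS]ger0_norm ?normc_ge0//.
  case: (f x) => a b /=; rewrite -sqrtr_sqr ler_wsqrtr// lerDr sqr_ge0//.
Qed.

(* In particular L2_inner v is the adjoint of c |-> c *: v. *)
Lemma L2_innerZl (c : R[i]) u v : L2_inner (c *: u) v = c^* * L2_inner u v.
Proof.
have [[mr mi] ir ii] := L2_inner_integrable u v.
have [[mr' mi'] _ _] := L2_inner_integrable (c *: u) v.
rewrite /L2_inner -cintegralZl//.
apply: eq_ae_cintegral => //; first exact: (cmeasurableM (cmeasurable_cst _ _)).
by apply: filterS (L2_funZ c u) => x ->; rewrite rmorphM mulrA.
Qed.

Lemma L2_norm_inner u : `|u| ^+ 2 = L2_inner u u.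
Proof.
have -> : `|u| = (L2_rnorm u)%:C by [].
rewrite -rmorphXn /L2_inner /cintegral; congr (_ +i* _); last first.
  rewrite (@eq_Rintegral _ _ _ m _ (cst 0)) ?Rintegral_cst ?mul0r// => x _.
  by case: (u x) => a b /=; rewrite mulNr [b * a]mulrC subrr.
have -> : L2_rnorm u ^+ 2 = fine ((L2_rnorm u)%:E `^ 2)%E.
  by rewrite poweR_EFin /= powR_mulrn// fine_ge0// Lnorm_ge0.
rewrite L2_rnormE poweR_Lnorm ?pnatr_eq0//; congr fine.
apply: eq_integral => x _.
rewrite /= powR_mulrn// ger0_norm ?normc_ge0// /cmodulus; congr (_%:E).
case: (u x) => a b /=; rewrite sqr_sqrtr ?addr_ge0 ?sqr_ge0//.
by rewrite mulNr opprK !expr2.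
Qed.

End L2_space.

Section linear_span.
Context (K : numFieldType) (U : normedModType K).

Definition linear_span (A : set U) : set U :=
  [set x | exists n (c : 'I_n -> K) (a : 'I_n -> U),
     (forall i, A (a i)) /\ x = \sum_(i < n) c i *: a i].

Definition cyclic_vector (A : U -> U) (v : U) : Prop :=
  closure (linear_span (range (fun n => iter n A v))) = setT.

End linear_span.

Section partial_operators.
Context (K : numFieldType) (U V : normedModType K).

(* Only the values of op_act on op_dom are meaningful. *)
Record partial_op := PartialOp { op_dom : set U ; op_act : U -> V }.

Implicit Type X : partial_op.

Definition linear_op X : Prop :=
  op_dom X 0 /\
  forall (a : K) x y, op_dom X x -> op_dom X y ->
    op_dom X (a *: x + y) /\
    op_act X (a *: x + y) = a *: op_act X x + op_act X y.

Definition densely_defined X : Prop := dense (op_dom X).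

Definition bounded_op X : Prop :=
  exists M : K, forall x, op_dom X x -> `|op_act X x| <= M * `|x|.

Definition op_graph X : set (U * V) :=
  [set p | op_dom X p.1 /\ op_act X p.1 = p.2].

(* The closure of the graph is again the graph of a map. *)
Definition closable X : Prop :=
  forall x y1 y2,
    closure (op_graph X) (x, y1) -> closure (op_graph X) (x, y2) -> y1 = y2.

(* B and Bs stand for the coupling V and its adjoint. *)
Definition strong_riccati_solution
    (A0 : U -> U) (A1 : V -> V) (B : V -> U) (Bs : U -> V) X : Prop :=
  [/\ linear_op X, densely_defined X &
      forall x, op_dom X x ->
        op_dom X (A0 x + B (op_act X x)) /\
        A1 (op_act X x) - op_act X (A0 x + B (op_act X x)) + Bs x = 0].

End partial_operators.

Section multiplication.
Context (R : realType) (m : {measure set (measurableTypeR R) -> \bar R}).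

Definition compactly_supported : Prop :=
  exists K : set R, compact K /\ m (~` K) = 0%E.

(* The class of f; the value 0 is junk, used when f is not square-integrable. *)
Definition L2_class (f : R -> R[i]^o) : L2 m :=
  if pselect (f \in sqint m) is left fP
  then \pi_(L2 m)%qT (SqInt fP) else 0.

(* See mulXE: the junk value of L2_class does not occur in mulX when m is
   compactly supported. *)
Definition mulX (u : L2 m) : L2 m := L2_class (fun x => x%:C * u x).

Lemma mulX_sqint (u : L2 m) : compactly_supported ->
  (fun x : R => x%:C * u x : R[i]^o) \in sqint m.
Proof.
move=> [K [cK mK0]]; have us := L2_fun_sqint u; have /sqintP[mu _] := us.
have mx : cmeasurable (fun x : measurableTypeR R => x%:C * u x).
  by apply: cmeasurableM => //; apply: cmeasurable_real; exact: measurable_id.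
have [M [_ KM]] := compact_bounded cK.
pose N := `|M| + 1.
apply/sqintP; split=> //.
have mNu := cmeasurableM (cmeasurable_cst (measurableTypeR R) N%:C) mu.
apply: (@le_lt_trans _ _
  ('N[m]_2%:E [EFin \o cmodulus (fun x => (N%:C * u x)%R)])%E).
  apply: le_ae_cLnorm => //; exists (~` K); split => //.
    by apply: measurableC; exact: compact_measurable.
  apply: subsetC => x Kx /=.
  rewrite /cmodulus !Normc.normcM ler_wpM2r ?normc_ge0//.
  rewrite /Normc.normc /= !expr0n /= !addr0 !sqrtr_sqr [`|N|]ger0_norm ?addr_ge0//.
  by apply: (KM N) => //; rewrite (le_lt_trans (ler_norm M))// ltrDl.
rewrite LnormZ_cmodulus// lte_mul_pinfty ?lee_fin ?normc_ge0//.
by have /sqintP[] := us.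
Qed.

Lemma mulXE (u : L2 m) : compactly_supported ->
  {ae m, forall x, mulX u x = x%:C * u x}.
Proof.
move=> /(mulX_sqint u) us; rewrite /mulX /L2_class.
case: pselect => [h|]; last by rewrite us.
exact: (L2_fun_pi (SqInt h)).
Qed.

End multiplication.

Section singular_integrals.
Context (R : realType) (m : {measure set (measurableTypeR R) -> \bar R}).
Implicit Types (lam a : R) (v : L2 m).

Definition cauchy_integral (f : R -> R[i]) lam (eps : R) : R[i]^o :=
  cintegral m (fun x => f x / (x%:C - (lam +i* eps))).

Definition S_s a v : set R :=
  [set lam | cauchy_integral (fun x => `|v x| ^+ 2) lam eps @[eps --> 0^'+]
             --> ((a - lam)%:C : R[i]^o)].

Definition inv_sq_dist lam (x : R) : \bar R :=
  if x == lam then +oo%E else ((`|x - lam| ^+ 2)^-1)%:E.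

(* The first integrand is 0 at x = lam by the convention on inverses; this is
   harmless because the second condition forces v x = 0 for m-almost every x
   in the singleton of lam. *)
Definition S_pp a v : set R :=
  [set lam |
    (a - lam)%:E = (\int[m]_x (cmodulus v x ^+ 2 / (x - lam))%:E)%E /\
    (\int[m]_x ((cmodulus v x ^+ 2)%:E * inv_sq_dist lam x) < +oo)%E].

Definition S_sc a v : set R := S_s a v `\` S_pp a v.

Definition X_op v lam : partial_op (L2 m) R[i]^o :=
  let F (phi : L2 m) := cauchy_integral (fun x => (v x)^* * phi x) lam in
  PartialOp [set phi | cvg (F phi eps @[eps --> 0^'+])]
            (fun phi => lim (F phi eps @[eps --> 0^'+])).

End singular_integrals.

(* Main.v *)
(* Write z = lam + i eps and R_eps = (A_0 - z)^-1, so that X_lam phi is the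
   limit of <v, R_eps phi>, and lam \in S_s says that v \in Dom X_lam with
   X_lam v = a_1 - lam.  From R_eps A_0 = 1 + z R_eps one gets
   X_lam (A_0 phi) = lam X_lam phi + <v, phi>; this yields the Riccati equation,
   and the invariance of Dom X_lam under A_0, hence its density by cyclicity.

   Let I be the integral of |v|^2 / |mu - lam|^2. If I is finite, then
   |<v, R_eps phi>| = |<R_{-eps} v, phi>| <= sqrt I |phi|, so X_lam is bounded.
   Conversely, a closable functional is bounded, and the resolvent identity
   gives R_eps v \in Dom X_lam with
   i eps X_lam (R_eps v) = <v, R_eps v> - (a_1 - lam).  Since
   Im <v, R_eps v> = eps |R_eps v|^2, a bound M for X_lam forces
   |R_eps v|^2 <= |X_lam (R_eps v)| <= M |R_eps v|, so that |R_eps v| <= M, and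
   I <= M^2 by monotone convergence as eps tends to 0.  A finite I places lam in
   S_pp. *)
Require Import Defs.
From HB Require Import structures.
From mathcomp Require Import all_boot all_order all_algebra complex.
From mathcomp Require Import all_classical all_reals all_analysis.
From mathcomp Require Import measurable_realfun ring lra.

Set Implicit Arguments.
Unset Strict Implicit.
Unset Printing Implicit Defensive.

Import Order.TTheory GRing.Theory Num.Theory.
Import numFieldNormedType.Exports.

Local Open Scope classical_set_scope.
Local Open Scope ring_scope.
Local Open Scope complex_scope.

(** * The kernel [(x - z)^-1] at a non-real point [z = lam + i eps] *)

Section complex_lemmas.
Context (R : realType).
Implicit Types (x lam eps : R) (z : R[i]).

Lemma subC_neq0 x lam eps : eps != 0 -> x%:C - (lam +i* eps) != 0.
Proof. by move=> e0; rewrite eq_complex /= negb_and sub0r oppr_eq0 e0 orbT. Qed.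

Lemma inv_subC x lam eps : (x%:C - (lam +i* eps))^-1 =
  ((x - lam) / ((x - lam) ^+ 2 + eps ^+ 2)) +i*
  (eps / ((x - lam) ^+ 2 + eps ^+ 2)).
Proof. by apply/eqP; rewrite eq_complex /= !sub0r sqrrN mulNr opprK !eqxx. Qed.

Lemma normr_Im_le_normc z : `|complex.Im z| <= Normc.normc z.
Proof.
by case: z => a b /=; rewrite -sqrtr_sqr ler_wsqrtr// lerDr sqr_ge0.
Qed.

Lemma normr_Re_le_normc z : `|complex.Re z| <= Normc.normc z.
Proof.
by case: z => a b /=; rewrite -sqrtr_sqr ler_wsqrtr// lerDl sqr_ge0.
Qed.

Lemma sqr_normc_inv_subC x lam eps :
  Normc.normc (x%:C - (lam +i* eps))^-1 ^+ 2 =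
  ((x - lam) ^+ 2 + eps ^+ 2)^-1.
Proof.
rewrite Normc.normcV exprVn /= sub0r sqrrN sqr_sqrtr//.
by rewrite addr_ge0 ?sqr_ge0.
Qed.

Lemma cmeasurable_inv_subC lam eps : eps != 0 ->
  cmeasurable (fun x : measurableTypeR R => (x%:C - (lam +i* eps))^-1).
Proof.
move=> e0.
have d0 x : (x - lam) ^+ 2 + eps ^+ 2 != 0.
  by rewrite gt_eqF// ltr_wpDl ?sqr_ge0// exprn_even_gt0.
have cs : continuous (fun x : R => x - lam).
  by move=> x; apply: cvgB; [exact: cvg_id|exact: cvg_cst].
have ci : continuous (fun x : R => ((x - lam) ^+ 2 + eps ^+ 2)^-1).
  move=> x; apply: cvgV => //; apply: cvgD; last exact: cvg_cst.
  by rewrite expr2; apply: cvgM; exact: cs.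
split.
- rewrite (_ : (fun x => _) =
    fun x : R => (x - lam) * ((x - lam) ^+ 2 + eps ^+ 2)^-1); last first.
    by apply/funext => x; rewrite inv_subC.
  by apply: continuous_measurable_fun => x; apply: cvgM; [exact: cs|exact: ci].
- rewrite (_ : (fun x => _) =
    fun x : R => eps * ((x - lam) ^+ 2 + eps ^+ 2)^-1); last first.
    by apply/funext => x; rewrite inv_subC.
  by apply: continuous_measurable_fun => x; apply: cvgM;
    [exact: cvg_cst|exact: ci].
Qed.

End complex_lemmas.

(** * Sesquilinearity and the Cauchy-Schwarz inequality in [L2 m] *)

Section L2_inner_theory.
Context d (T : measurableType d) (R : realType) (m : {measure set T -> \bar R}).
Implicit Types (u v w : L2 m) (c : R[i]).

Lemma L2_normE u : `|u| = (L2_rnorm u)%:C. Proof. by []. Qed.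

Lemma L2_rnorm_ge0 u : 0 <= L2_rnorm u.
Proof. by rewrite fine_ge0 ?Lnorm_ge0. Qed.

Lemma L2_innerDr u v w : L2_inner u (v + w) = L2_inner u v + L2_inner u w.
Proof.
have [mvw _ _] := L2_inner_integrable u (v + w).
have [mv rv iv] := L2_inner_integrable u v.
have [mw rw iw] := L2_inner_integrable u w.
rewrite /L2_inner (eq_ae_cintegral mvw (cmeasurableD mv mw)); last first.
  by apply: filterS (L2_funD v w) => x ->; rewrite mulrDr.
rewrite /cintegral; apply/eqP; rewrite eq_complex/=.
apply/andP; split; apply/eqP.
  rewrite -RintegralD//; apply: eq_Rintegral => x _.
  by case: (_ * _) => a b; case: (_ * _).
rewrite -RintegralD//; apply: eq_Rintegral => x _.
by case: (_ * _) => a b; case: (_ * _).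
Qed.

Lemma L2_innerZr c u v : L2_inner u (c *: v) = c * L2_inner u v.
Proof.
have [mcv _ _] := L2_inner_integrable u (c *: v).
have [mv rv iv] := L2_inner_integrable u v.
rewrite /L2_inner -cintegralZl//; apply: eq_ae_cintegral => //.
  exact: (cmeasurableM (cmeasurable_cst _ _)).
by apply: filterS (L2_funZ c v) => x ->; rewrite mulrCA.
Qed.

Lemma L2_inner_ae u v u' v' :
  {ae m, forall x, (u x)^* * v x = (u' x)^* * v' x} ->
  L2_inner u v = L2_inner u' v'.
Proof.
have [? _ _] := L2_inner_integrable u v.
have [? _ _] := L2_inner_integrable u' v'.
exact: eq_ae_cintegral.
Qed.

(** Hölder with exponents 2 and 2, applied to the moduli. The real part suffices: a rotation of [u]
    then gives Cauchy-Schwarz. *)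
Lemma Re_L2_inner_le u v : complex.Re (L2_inner u v) <= L2_rnorm u * L2_rnorm v.
Proof.
have [_ rv _] := L2_inner_integrable u v.
have us := L2_fun_sqint u; have vs := L2_fun_sqint v.
have /sqintP[/measurable_cmodulus mu _] := us.
have /sqintP[/measurable_cmodulus mv _] := vs.
have fi := proj1 (Lfun1_integrable m _)
  (Lfun2_mul_Lfun1 (cmodulus_Lfun us) (cmodulus_Lfun vs)).
apply: (@le_trans _ _ (\int[m]_x (cmodulus u x * cmodulus v x))).
  apply: le_Rintegral => // x _.
  have -> : cmodulus u x * cmodulus v x = Normc.normc ((u x)^* * v x).
    rewrite Normc.normcM /cmodulus; congr (_ * _).
    by case: (u x) => a b /=; rewrite sqrrN.
  exact: le_trans (ler_norm _) (normr_Re_le_normc _).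
rewrite -lee_fin EFinM !L2_rnormE.
apply: le_trans (hoelder m mu mv _ _ _); rewrite ?ltr0n//; last first.
  by rewrite -mulr2n -[LHS]mulr_natr mulVf// pnatr_eq0.
rewrite fineK; last exact: integrable_fin_num.
rewrite Lnorm1; apply: ge0_le_integral => //.
- by move=> x _; rewrite lee_fin mulr_ge0// normc_ge0.
- by apply/measurable_EFinP; exact: measurable_funM.
- apply: measurableT_comp => //; apply/measurable_EFinP; exact: measurable_funM.
- by move=> x _; rewrite lee_fin ler_norm.
Qed.

(** With [z = <u, v>], the number [<z u, v> = |z|^2] is real, so the bound on real parts gives
    [|z|^2 <= |z| |u| |v|]. *)
Lemma L2_inner_CauchySchwarz u v : `|L2_inner u v| <= `|u| * `|v|.
Proof.
set z := L2_inner u v; have [->|z0] := eqVneq z 0.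
  by rewrite normr0 mulr_ge0.
rewrite -(ler_pM2l (_ : 0 < `|z|)) ?normr_gt0//.
have : `|z| * `|z| = L2_inner (z *: u) v.
  by rewrite L2_innerZl -/z -expr2 sqr_normc mulrC.
have := Re_L2_inner_le (z *: u) v; move: (L2_inner _ v) => w wle zw.
rewrite zw mulrA -(normrZ z u) !L2_normE -rmorphM /=.
have zr : w \is Num.real by rewrite -zw realM ?normr_real.
move: zr wle; case: (w) => a b; rewrite complex_real/= => /eqP ->.
by rewrite lecR.
Qed.

End L2_inner_theory.

(** * The resolvent of multiplication by [x] off the real axis *)

Section resolvent.
Context (R : realType) (m : {measure set (measurableTypeR R) -> \bar R}).
Implicit Types (u v w phi : L2 m) (lam eps del : R).

Lemma L2_class_ae (f : R -> R[i]^o) : f \in sqint m ->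
  {ae m, forall x, L2_class m f x = f x}.
Proof.
rewrite /L2_class; case: pselect => [fP _|/[swap] -> //].
exact: (L2_fun_pi (SqInt fP)).
Qed.

(* Meaningful for eps != 0 only: at eps = 0 the quotient need not be square
   integrable, in which case L2_class returns 0. *)
Definition resolvent lam eps u : L2 m :=
  L2_class m (fun x => u x / (x%:C - (lam +i* eps))).

(** Since [|x - z| >= |Im (x - z)| = |eps|], the quotient is dominated by [|eps|^-1 |u|]. *)
Lemma resolvent_sqint lam eps u : eps != 0 ->
  (fun x : R => u x / (x%:C - (lam +i* eps)) : R[i]^o) \in sqint m.
Proof.
move=> e0; have us := L2_fun_sqint u; have /sqintP[mu fu] := us.
have mr := cmeasurableM mu (cmeasurable_inv_subC lam e0).
apply/sqintP; split=> //.
have mc := cmeasurableM (cmeasurable_cst (measurableTypeR R) (`|eps|^-1)%:C) mu.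
apply: (@le_lt_trans _ _
  ('N[m]_2%:E [EFin \o cmodulus (fun x => (`|eps|^-1%:C * u x)%R)])%E).
  apply: le_ae_cLnorm => //; apply: nearW => x.
  rewrite /cmodulus !Normc.normcM mulrC ler_wpM2r ?normc_ge0//.
  have -> : Normc.normc `|eps|^-1%:C = `|eps|^-1.
    by rewrite /Normc.normc /= expr0n/= addr0 sqrtr_sqr normfV normr_id.
  rewrite Normc.normcV.
  rewrite lef_pV2 ?posrE ?normr_gt0//; last first.
    rewrite lt0r normc_ge0 andbT.
    by apply: contra_neq (subC_neq0 x lam e0); exact: Normc.eq0_normc.
  by apply: le_trans (normr_Im_le_normc _); rewrite /= sub0r normrN.
by rewrite LnormZ_cmodulus// lte_mul_pinfty ?lee_fin ?normc_ge0.
Qed.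

Lemma resolventE lam eps u : eps != 0 ->
  {ae m, forall x, resolvent lam eps u x = u x / (x%:C - (lam +i* eps))}.
Proof. by move=> e0; apply: L2_class_ae; exact: resolvent_sqint. Qed.

Lemma cauchy_integralE lam eps v phi : eps != 0 ->
  cauchy_integral m (fun x => (v x)^* * phi x) lam eps =
  L2_inner v (resolvent lam eps phi).
Proof.
move=> e0; have [mi _ _] := L2_inner_integrable v (resolvent lam eps phi).
have [mv _ _] := L2_inner_integrable v phi.
apply: eq_ae_cintegral => //.
  exact: (cmeasurableM mv (cmeasurable_inv_subC lam e0)).
by apply: filterS (resolventE lam phi e0) => x ->; rewrite mulrA.
Qed.

Lemma cauchy_integral_sqrE lam eps v : eps != 0 ->
  cauchy_integral m (fun x => `|v x| ^+ 2) lam eps =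
  L2_inner v (resolvent lam eps v).
Proof.
move=> e0; rewrite -cauchy_integralE//; congr (cintegral _ _).
by apply/funext => x; rewrite sqr_normc [_^* * _]mulrC.
Qed.

Lemma resolventP lam eps (a : R[i]) u w : eps != 0 ->
  resolvent lam eps (a *: u + w) =
  a *: resolvent lam eps u + resolvent lam eps w.
Proof.
move=> e0; apply/L2_funP; near=> x.
rewrite (near (resolventE lam (a *: u + w) e0) x)//.
rewrite (near (L2_funD (a *: u) w) x)// (near (L2_funZ a u) x)//.
rewrite (near (L2_funD (a *: resolvent lam eps u) (resolvent lam eps w)) x)//.
rewrite (near (L2_funZ a (resolvent lam eps u)) x)//.
rewrite (near (resolventE lam u e0) x)// (near (resolventE lam w e0) x)//.
by rewrite mulrDl mulrA.
Unshelve. all: by end_near. Qed.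

Lemma resolvent_mulX lam eps u : compactly_supported m -> eps != 0 ->
  resolvent lam eps (mulX u) = (lam +i* eps) *: resolvent lam eps u + u.
Proof.
move=> hm e0; apply/L2_funP; near=> x.
rewrite (near (resolventE lam (mulX u) e0) x)//.
rewrite (near (mulXE u hm) x)//.
rewrite (near (L2_funD ((lam +i* eps) *: resolvent lam eps u) u) x)//.
rewrite (near (L2_funZ (lam +i* eps) (resolvent lam eps u)) x)//.
rewrite (near (resolventE lam u e0) x)//.
have x0 := subC_neq0 x lam e0.
rewrite -[X in X * u x](subrK (lam +i* eps)).
by field.
Unshelve. all: by end_near. Qed.

Lemma resolvent_identity lam eps del u : eps != 0 -> del != 0 ->
  (0 +i* (del - eps)) *: resolvent lam eps (resolvent lam del u) =
  resolvent lam del u - resolvent lam eps u.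
Proof.
move=> e0 d0; rewrite -[X in _ = _ + X]scaleN1r [RHS]addrC.
apply/L2_funP; near=> x.
rewrite (near (L2_funZ (0 +i* (del - eps))
  (resolvent lam eps (resolvent lam del u))) x)//.
rewrite (near (resolventE lam (resolvent lam del u) e0) x)//.
rewrite (near (L2_funD ((-1) *: resolvent lam eps u)
  (resolvent lam del u)) x)//.
rewrite (near (L2_funZ (-1) (resolvent lam eps u)) x)//.
rewrite (near (resolventE lam u e0) x)// (near (resolventE lam u d0) x)//.
have := subC_neq0 x lam e0; have := subC_neq0 x lam d0.
set p := _ - (lam +i* del); set q := _ - (lam +i* eps) => p0 q0.
(* The scalar is the difference of the two denominators, so the claim becomes the partial fraction
   [(q - p) / (p q) = 1 / p - 1 / q]. *)
have -> : 0 +i* (del - eps) = q - p.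
  apply/eqP; rewrite eq_complex /= opprB addrA.
  by apply/andP; split; apply/eqP; ring.
by field; rewrite p0 q0.
Unshelve. all: by end_near. Qed.

Lemma conj_subC x lam eps :
  ((x%:C - (lam +i* eps))^*)%R = x%:C - (lam +i* (- eps)).
Proof. by apply/eqP; rewrite eq_complex /= !sub0r !opprK !eqxx. Qed.

(** Conjugating the kernel replaces [z] by its conjugate, that is, [eps] by [- eps]. *)
Lemma resolvent_adjoint lam eps u w : eps != 0 ->
  L2_inner u (resolvent lam eps w) = L2_inner (resolvent lam (- eps) u) w.
Proof.
move=> e0; have ne0 : - eps != 0 by rewrite oppr_eq0.
apply: L2_inner_ae; near=> x.
rewrite (near (resolventE lam w e0) x)// (near (resolventE lam u ne0) x)//.
rewrite [(u x / _)^*%R]rmorphM /= fmorphV.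
rewrite [X in _ = _ / X * _](conj_subC x lam (- eps)) opprK.
by rewrite mulrA mulrAC.
Unshelve. all: by end_near. Qed.

(** Pointwise, [Im (x - z)^-1 = eps / |x - z|^2], and [|u|^2 / |x - z|^2] is the squared modulus of
    the resolvent applied to [u]. *)
Lemma Im_L2_inner_resolvent lam eps u : eps != 0 ->
  complex.Im (L2_inner u (resolvent lam eps u)) =
  eps * L2_rnorm (resolvent lam eps u) ^+ 2.
Proof.
move=> e0; have [mr rr _] :=
  L2_inner_integrable (resolvent lam eps u) (resolvent lam eps u).
have -> : L2_rnorm (resolvent lam eps u) ^+ 2 =
    complex.Re (L2_inner (resolvent lam eps u) (resolvent lam eps u)).
  by rewrite -L2_norm_inner L2_normE -rmorphXn.
have [mi _ _] := L2_inner_integrable u (resolvent lam eps u).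
rewrite /L2_inner /= -RintegralZl// /Rintegral; congr fine.
apply: ae_eq_integral => //.
- by apply/measurable_EFinP; case: mi.
- by apply/measurable_EFinP; apply: measurable_funM => //; case: mr.
apply: filterS (resolventE lam u e0) => x ux _; congr (_%:E).
rewrite ux inv_subC; case: (u x) => a b /=.
have d0 : (x - lam) ^+ 2 + eps ^+ 2 != 0.
  by rewrite gt_eqF// ltr_wpDl ?sqr_ge0// exprn_even_gt0.
by field.
Qed.

(** Kept in the extended reals for comparison with the integral of [|u|^2 / |x - lam|^2], which may
    be infinite. *)
Lemma L2_rnorm_resolvent lam eps u : eps != 0 ->
  ((L2_rnorm (resolvent lam eps u) ^+ 2)%:E =
   \int[m]_x (cmodulus u x ^+ 2 / ((x - lam) ^+ 2 + eps ^+ 2))%:E)%E.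
Proof.
move=> e0; set r := resolvent lam eps u.
have /sqintP[mu _] := L2_fun_sqint u; have /sqintP[mr _] := L2_fun_sqint r.
have mi := cmeasurable_inv_subC lam e0.
have -> : L2_rnorm r ^+ 2 = fine ((L2_rnorm r)%:E `^ 2)%E.
  by rewrite poweR_EFin /= powR_mulrn// L2_rnorm_ge0.
rewrite fineK; last by rewrite poweR_EFin.
rewrite L2_rnormE poweR_Lnorm ?pnatr_eq0//.
have mc (f : R -> R[i]) : cmeasurable (f : measurableTypeR R -> R[i]) ->
    measurable_fun setT (fun x : measurableTypeR R => (cmodulus f x) ^+ 2).
  by move=> /measurable_cmodulus mf; exact: measurable_funX.
have pE x : (`|(EFin \o cmodulus r) x| `^ 2 = (cmodulus r x ^+ 2)%:E)%E.
  by rewrite /= powR_mulrn// ger0_norm// normc_ge0.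
under eq_integral do rewrite pE.
have uE x : cmodulus u x ^+ 2 / ((x - lam) ^+ 2 + eps ^+ 2) =
    cmodulus (fun x => u x / (x%:C - (lam +i* eps))) x ^+ 2.
  by rewrite /cmodulus Normc.normcM exprMn sqr_normc_inv_subC.
under [RHS]eq_integral do rewrite uE.
apply: ge0_ae_eq_integral => //.
- by apply/measurable_EFinP; exact: mc.
- by apply/measurable_EFinP; apply: mc; exact: cmeasurableM.
- by move=> x _; rewrite lee_fin sqr_ge0.
- by move=> x _; rewrite lee_fin sqr_ge0.
by apply: filterS (resolventE lam u e0) => x ux _; rewrite /cmodulus ux.
Qed.

End resolvent.

(** If the functional is unbounded, rescaling gives vectors of arbitrarily small norm on which it
    takes the value 1. Then [(0, 1)] joins [(0, 0)] in the closure of the graph. *)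
Lemma closable_bounded (K : numFieldType) (U : normedModType K)
  (X : partial_op U K^o) : linear_op X -> closable X -> bounded_op X.
Proof.
move=> [X0 Xlin] clX; apply: contrapT => nbX.
have XZ (a : K) x : op_dom X x ->
    op_dom X (a *: x) /\ op_act X (a *: x) = a * op_act X x.
  move=> Xx; have [_] := Xlin a 0 0 X0 X0; rewrite scaler0 addr0 => X00.
  have [] := Xlin a x 0 Xx X0; rewrite addr0 => ? ->; split => //.
  have [_] := Xlin 1 0 0 X0 X0.
  rewrite !scale1r addr0 => /eqP; rewrite -subr_eq0 opprD addrA subrr sub0r.
  by rewrite oppr_eq0 => /eqP ->; rewrite addr0.
have X00 : op_act X 0 = 0.
  by have [_] := XZ 0 0 X0; rewrite scaler0 mul0r.
have cl0 : closure (op_graph X) (0, 0).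
  by apply: subset_closure; split.
suff : closure (op_graph X) (0, 1).
  by move=> /(clX _ _ _ cl0)/eqP; rewrite eq_sym oner_eq0.
move=> B [[B1 B2] /= [/nbhs_ballP[e /= e0 B1e] B2n] B12].
(* Otherwise [e^-1] would be a bound for the functional. *)
have [x [Xx xlt]] : exists x, op_dom X x /\ `|x| < e * `|op_act X x|.
  apply: contrapT => nx; apply: nbX; exists e^-1 => x Xx.
  rewrite mulrC ler_pdivlMr// mulrC real_leNgt ?ger0_real ?mulr_ge0 ?(ltW e0)//.
  by apply/negP => lt; apply: nx; exists x.
have a0 : op_act X x != 0.
  by apply: contraTneq xlt => ->; rewrite normr0 mulr0 normr_lt0.
have [Xy Xy1] := XZ (op_act X x)^-1 x Xx.
exists ((op_act X x)^-1 *: x, 1); split; first by split; rewrite //= Xy1 mulVf.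
apply: B12; split => /=; last exact: nbhs_singleton.
apply: B1e; rewrite -ball_normE /= sub0r normrN normrZ normfV.
by rewrite mulrC ltr_pdivrMr ?normr_gt0.
Qed.

(** * The weight [|x - lam|^-2] as a limit of regularized weights *)

Section inverse_square.
Context (R : realType).
Implicit Types (lam c x t : R).

Lemma inv_sq_dist_ge0 lam x : (0 <= inv_sq_dist lam x)%E.
Proof. by rewrite /inv_sq_dist; case: ifP => // _; rewrite lee_fin invr_ge0. Qed.

(** The case [eps = 0] is included and serves in [S_s_pp]: at [x = lam] the left side is then 0 by
    the convention on inverses. *)
Lemma le_inv_sq_dist lam c eps x :
  ((c ^+ 2 / ((x - lam) ^+ 2 + eps ^+ 2))%:E <=
   (c ^+ 2)%:E * inv_sq_dist lam x)%E.
Proof.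
rewrite /inv_sq_dist; case: eqP => [->|/eqP xl].
  have [->|c0] := eqVneq c 0; first by rewrite expr0n mul0r mul0e.
  by rewrite gt0_muley ?leey// lte_fin exprn_even_gt0.
rewrite -EFinM lee_fin ler_wpM2l ?sqr_ge0// real_normK ?num_real//.
have t0 : 0 < (x - lam) ^+ 2 by rewrite exprn_even_gt0//= subr_eq0.
by rewrite lef_pV2 ?posrE ?ltr_wpDr ?sqr_ge0// lerDl sqr_ge0.
Qed.

Lemma cvg_sqr_harmonic : (n.+1%:R^-1 : R) ^+ 2 @[n --> \oo] --> (0 : R).
Proof.
rewrite -[X in _ --> X](mulr0 0); under eq_fun do rewrite expr2.
by apply: cvgM; exact: cvg_harmonic.
Qed.

(** The parameter [eps] runs through [1 / (n + 1)], a sequence as monotone convergence requires. At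
    [x = lam] the terms are [c^2 (n + 1)^2]: they diverge if [c != 0] and vanish if [c = 0], in
    accordance with [0 * oo = 0]. *)
Lemma cvg_inv_sq_dist lam c x :
  (c ^+ 2 / ((x - lam) ^+ 2 + (n.+1%:R^-1) ^+ 2))%:E @[n --> \oo] -->
  ((c ^+ 2)%:E * inv_sq_dist lam x)%E.
Proof.
rewrite /inv_sq_dist; case: eqP => [->|/eqP xl].
  have [->|c0] := eqVneq c 0.
    by rewrite expr0n mul0e; under eq_fun do rewrite mul0r; exact: cvg_cst.
  have c20 : 0 < c ^+ 2 by rewrite exprn_even_gt0.
  rewrite gt0_muley ?lte_fin//; apply/cvgeyPge => A; near=> n.
  rewrite lee_fin subrr expr0n add0r exprVn invrK -ler_pdivrMl//.
  have le1 : n%:R <= n.+1%:R ^+ 2 :> R.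
    by rewrite expr2 -natrM ler_nat mulSn (leq_trans (leqnSn n))// leq_addr.
  by apply: le_trans le1; near: n; exact: nbhs_infty_ger.
rewrite -EFinM; apply: cvg_EFin; first exact: nearW.
rewrite real_normK ?num_real//; apply: cvgM; first exact: cvg_cst.
have t0 : (x - lam) ^+ 2 != 0 by rewrite expf_eq0 /= subr_eq0.
apply: cvgV => //; rewrite -[X in _ --> X]addr0.
by apply: cvgD; [exact: cvg_cst|exact: cvg_sqr_harmonic].
Unshelve. all: by end_near. Qed.

(** A pointwise limit of real parts of [(x - z)^-1]; at [x = lam] these are all 0, which agrees with
    [0^-1 = 0]. *)
Lemma measurable_inv_sub lam :
  measurable_fun setT (fun x : measurableTypeR R => (x - lam)^-1).
Proof.
pose h n (x : measurableTypeR R) :=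
  complex.Re (x%:C - (lam +i* (n.+1%:R^-1)))^-1.
apply: (@measurable_fun_cvg _ _ _ _ h) => [n|x _].
  by have [] := @cmeasurable_inv_subC R lam n.+1%:R^-1 _.
rewrite /h; under eq_fun do rewrite inv_subC /=.
have [->|xl] := eqVneq x lam.
  by rewrite subrr invr0; under eq_fun do rewrite mul0r; exact: cvg_cst.
have t0 : x - lam != 0 by rewrite subr_eq0.
rewrite (_ : (x - lam)^-1 = (x - lam) / ((x - lam) ^+ 2 + 0)); last first.
  by rewrite addr0; field.
apply: cvgM; first exact: cvg_cst.
apply: cvgV; first by rewrite addr0 expf_eq0.
by apply: cvgD; [exact: cvg_cst|exact: cvg_sqr_harmonic].
Qed.

End inverse_square.

(** * The functional [X_op v lam] and the Riccati equation *)

Lemma cvg_spectral_parameter (R : realType) (lam : R) :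
  (lam +i* eps : R[i]^o) @[eps --> 0^'+] --> (lam%:C : R[i]^o).
Proof.
apply/cvgrPdist_le => /= e e0; have e0' := e0.
(* Positivity in [R[i]] means that [e] is real with positive real part. *)
move: e0'; rewrite ltcE /= => /andP[/eqP ei er].
near=> eps; have eps0 : 0 < eps by near: eps; exact: nbhs_right_gt.
have -> : lam%:C - (lam +i* eps) = 0 +i* (- eps).
  by apply/eqP; rewrite eq_complex /= subrr sub0r !eqxx.
rewrite [`|_|]normc_def lecE /= ei eqxx /= expr0n add0r sqrrN sqrtr_sqr.
by rewrite gtr0_norm//; near: eps; exact: nbhs_right_le.
Unshelve. all: by end_near. Qed.

Section X_op_theory.
Context (R : realType) (m : {measure set (measurableTypeR R) -> \bar R}).
Variables (v : L2 m) (lam : R).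
Implicit Types (phi : L2 m).
Let X := X_op v lam.

Let near_eps_neq0 : \forall eps \near (0 : R)^'+, eps != 0.
Proof.
by near do rewrite gt_eqF//; exact: nbhs_right_gt.
Unshelve. all: by end_near. Qed.

(** Together with [X_op_cvg], this exchanges Cauchy integrals for inner products with resolvents;
    the two agree for [eps != 0], hence near [0] from the right. *)
Lemma X_op_cvgP phi (l : R[i]^o) :
  (L2_inner v (resolvent lam eps phi) : R[i]^o) @[eps --> 0^'+] --> l ->
  op_dom X phi /\ op_act X phi = l.
Proof.
move=> cl; have {}cl : cauchy_integral m (fun x => (v x)^* * phi x) lam eps
    @[eps --> 0^'+] --> l.
  apply: cvg_trans cl; apply: near_eq_cvg.
  by near=> eps; rewrite cauchy_integralE//; near: eps.
split; first by apply/cvg_ex; exists l.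
exact: cvg_lim cl.
Unshelve. all: by end_near. Qed.

Lemma X_op_cvg phi : op_dom X phi ->
  (L2_inner v (resolvent lam eps phi) : R[i]^o) @[eps --> 0^'+] -->
  op_act X phi.
Proof.
move=> Xphi; apply: cvg_trans Xphi; apply: near_eq_cvg.
by near=> eps; rewrite cauchy_integralE//; near: eps.
Unshelve. all: by end_near. Qed.

Lemma S_s_X_op a : S_s a v lam ->
  op_dom X v /\ op_act X v = (a - lam)%:C.
Proof.
move=> Ss; apply: X_op_cvgP; apply: cvg_trans Ss; apply: near_eq_cvg.
by near=> eps; rewrite cauchy_integral_sqrE//; near: eps.
Unshelve. all: by end_near. Qed.

Lemma X_op_linear_comb (a : R[i]) x y : op_dom X x -> op_dom X y ->
  op_dom X (a *: x + y) /\
  op_act X (a *: x + y) = a *: op_act X x + op_act X y.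
Proof.
move=> /X_op_cvg Xx /X_op_cvg Xy; apply: X_op_cvgP.
apply: cvg_trans (cvgD (cvgZl_tmp (k := a) Xx) Xy); apply: near_eq_cvg.
near=> eps.
have e0 : eps != 0 by near: eps.
by rewrite resolventP// L2_innerDr L2_innerZr.
Unshelve. all: by end_near. Qed.

Lemma X_op_linear a : S_s a v lam -> linear_op X.
Proof.
move=> /S_s_X_op[Xv _]; split; last exact: X_op_linear_comb.
(* The zero vector is reached as [- v + v]. *)
by have [+ _] := X_op_linear_comb (-1) Xv Xv; rewrite scaleN1r addNr.
Qed.

Lemma X_op_mulX phi : compactly_supported m -> op_dom X phi ->
  op_dom X (mulX phi) /\
  op_act X (mulX phi) = lam%:C * op_act X phi + L2_inner v phi.
Proof.
move=> hm /X_op_cvg Xphi; apply: X_op_cvgP.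
apply: cvg_trans (cvgD (cvgM (@cvg_spectral_parameter R lam) Xphi)
  (cvg_cst (L2_inner v phi : R[i]^o))).
apply: near_eq_cvg; near=> eps.
have e0 : eps != 0 by near: eps.
by rewrite resolvent_mulX// L2_innerDr L2_innerZr.
Unshelve. all: by end_near. Qed.

Lemma X_op_densely_defined a : compactly_supported m -> S_s a v lam ->
  cyclic_vector (@mulX R m) v -> densely_defined X.
Proof.
move=> hm Ss cv; have [X0 Xlin] := X_op_linear Ss; have [Xv _] := S_s_X_op Ss.
have Xiter n : op_dom X (iter n (@mulX R m) v).
  by elim: n => [//|n Xn]; have [] := X_op_mulX hm Xn.
have Xspan y : linear_span (range (fun n => iter n (@mulX R m) v)) y ->
    op_dom X y.
  move=> [n [c [b [bP ->]]]].
  elim/big_ind: _ => [|x z Xx Xz|i _]; first exact: X0.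
    by rewrite -[x]scale1r; have [] := Xlin 1 x z Xx Xz.
  have [k _ <-] := bP i.
  by have [] := Xlin (c i) _ 0 (Xiter k) X0; rewrite addr0.
move=> O [x Ox] oO.
have : closure (linear_span (range (fun n => iter n (@mulX R m) v))) x.
  by rewrite cv.
move=> /(_ O (open_nbhs_nbhs (conj oO Ox)))[y [ys Oy]].
by exists y; split; [exact: Oy|exact: Xspan].
Qed.

(** By linearity, [X (A_0 x + (X x) v) = lam X x + <v, x> + (a - lam) X x = a X x + <v, x>], where
    [X v = a - lam] comes from [S_s]. *)
Lemma X_op_strong_solution a : compactly_supported m -> S_s a v lam ->
  cyclic_vector (@mulX R m) v ->
  strong_riccati_solution (@mulX R m) (fun c : R[i]^o => a%:C * c : R[i]^o)
    (fun c : R[i]^o => c *: v) (fun x => L2_inner v x : R[i]^o) X.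
Proof.
move=> hm Ss cv; split; first exact: X_op_linear Ss.
  exact: X_op_densely_defined Ss cv.
move=> x Xx; have [Xv Xve] := S_s_X_op Ss; have [XAx XAxe] := X_op_mulX hm Xx.
rewrite addrC; have [Xy ->] := X_op_linear_comb (op_act X x) Xv XAx.
split=> //; rewrite Xve XAxe rmorphB /=.
rewrite /GRing.scale /=; ring.
Qed.

(** * Norms of [resolvent lam eps v] against the integral of [|v|^2 / |x - lam|^2] *)

Let measurable_cauchy_density eps : eps != 0 ->
  measurable_fun setT (fun x : measurableTypeR R =>
    (cmodulus v x ^+ 2 / ((x - lam) ^+ 2 + eps ^+ 2))%:E).
Proof.
have /sqintP[/measurable_cmodulus mv _] := L2_fun_sqint v.
move=> e0; apply/measurable_EFinP; apply: measurable_funM.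
  exact: measurable_funX.
have -> : (fun x : measurableTypeR R => ((x - lam) ^+ 2 + eps ^+ 2)^-1) =
    (fun x => cmodulus
      (fun y : measurableTypeR R => ((y : R)%:C - (lam +i* eps))^-1) x ^+ 2).
  by apply/funext => x; rewrite /cmodulus sqr_normc_inv_subC.
apply: measurable_funX; apply: measurable_cmodulus.
exact: cmeasurable_inv_subC.
Qed.

Lemma measurable_sqr_inv_sq_dist :
  measurable_fun setT (fun x : measurableTypeR R =>
    ((cmodulus v x ^+ 2)%:E * inv_sq_dist lam x)%E).
Proof.
apply: (emeasurable_fun_cvg (fun n (x : measurableTypeR R) =>
  (cmodulus v x ^+ 2 / ((x - lam) ^+ 2 + (n.+1%:R^-1) ^+ 2))%:E)).
  by move=> n; apply: measurable_cauchy_density; rewrite invr_neq0// pnatr_eq0.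
by move=> x _; exact: cvg_inv_sq_dist.
Qed.

Lemma L2_rnorm_resolvent_le eps : eps != 0 ->
  (((L2_rnorm (resolvent lam eps v)) ^+ 2)%:E <=
   \int[m]_x ((cmodulus v x ^+ 2)%:E * inv_sq_dist lam x))%E.
Proof.
move=> e0; rewrite L2_rnorm_resolvent//; apply: ge0_le_integral => //.
- by move=> x _; rewrite lee_fin mulr_ge0 ?invr_ge0 ?addr_ge0 ?sqr_ge0.
- exact: measurable_cauchy_density.
- exact: measurable_sqr_inv_sq_dist.
- by move=> x _; exact: le_inv_sq_dist.
Qed.

(** Along [eps = 1 / (n + 1)] the regularized integrands increase to the singular one, and their
    integrals are the squared resolvent norms; monotone convergence applies. *)
Lemma integral_inv_sq_dist_le (M : R) :
  (forall eps, 0 < eps -> L2_rnorm (resolvent lam eps v) <= M) ->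
  (\int[m]_x ((cmodulus v x ^+ 2)%:E * inv_sq_dist lam x) <= (M ^+ 2)%:E)%E.
Proof.
move=> hM; pose g n (x : measurableTypeR R) :=
  ((cmodulus v x ^+ 2 / ((x - lam) ^+ 2 + (n.+1%:R^-1) ^+ 2))%:E : \bar R).
have mg n : measurable_fun setT (g n).
  by apply: measurable_cauchy_density; rewrite invr_neq0// pnatr_eq0.
have g0 n x : setT x -> (0 <= g n x)%E.
  by rewrite lee_fin mulr_ge0 ?invr_ge0 ?addr_ge0 ?sqr_ge0.
have gn x : setT x -> {homo g^~ x : n k / (n <= k)%N >-> (n <= k)%E}.
  move=> _ n k nk; rewrite lee_fin ler_wpM2l ?sqr_ge0//.
  rewrite lef_pV2 ?posrE ?ltr_wpDl ?sqr_ge0// ?exprn_gt0 ?invr_gt0 ?ltr0n//.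
  rewrite lerD2l ler_sqr ?nnegrE ?invr_ge0 ?ler0n//.
  by rewrite lef_pV2 ?posrE ?ltr0n// ler_nat.
have := cvg_monotone_convergence (mu := m) measurableT mg g0 gn.
have -> : (\int[m]_x limn (g^~ x) =
    \int[m]_x ((cmodulus v x ^+ 2)%:E * inv_sq_dist lam x))%E.
  by apply: eq_integral => x _; apply: cvg_lim => //; exact: cvg_inv_sq_dist.
move=> cl; rewrite -(cvg_lim _ cl)//.
apply: lime_le; first by apply/cvg_ex; eexists; exact: cl.
apply: nearW => n.
have n0 : (n.+1%:R^-1 : R) != 0 by rewrite invr_neq0// pnatr_eq0.
rewrite -L2_rnorm_resolvent// lee_fin ler_sqr ?nnegrE ?L2_rnorm_ge0//.
  by apply: hM; rewrite invr_gt0 ltr0n.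
(* [M] is nonnegative because it dominates a norm, here the one at [eps = 1]. *)
by apply: le_trans (hM 1 ltr01); exact: L2_rnorm_ge0.
Qed.

End X_op_theory.

(** * Boundedness of [X_op v lam], finiteness of [I], and membership in [S_pp] *)

Section boundedness.
Context (R : realType) (m : {measure set (measurableTypeR R) -> \bar R}).
Variables (v : L2 m) (lam : R).
Let X := X_op v lam.
Let I := (\int[m]_x ((cmodulus v x ^+ 2)%:E * inv_sq_dist lam x))%E.

Lemma X_op_bounded : (I < +oo)%E -> bounded_op X.
Proof.
move=> Ioo; pose M := Num.sqrt (fine I).
have I0 : (0 <= I)%E.
  apply: integral_ge0 => x _.
  by rewrite mule_ge0 ?lee_fin ?sqr_ge0// inv_sq_dist_ge0.
(* Both signs of [eps] are covered, as passing to the adjoint turns [eps] into [- eps]. *)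
have RM eps : eps != 0 -> L2_rnorm (resolvent lam eps v) <= M.
  move=> e0; rewrite -(ler_pXn2r (n := 2))// ?nnegrE ?sqrtr_ge0 ?L2_rnorm_ge0//.
  rewrite sqr_sqrtr ?fine_ge0// -lee_fin fineK ?ge0_fin_numE//.
  exact: L2_rnorm_resolvent_le.
exists M%:C => phi /X_op_cvg Xphi.
have -> : `|op_act X phi| = (Normc.normc (op_act X phi))%:C by [].
rewrite L2_normE -rmorphM lecR; apply/ler_addgt0Pr => e e0.
have e0' : 0 < e%:C :> R[i] by rewrite ltcR.
move/cvgrPdist_le : Xphi => /(_ _ e0') Xphi.
near (0 : R)^'+ => eps.
have eps0 : eps != 0 by rewrite gt_eqF//; near: eps; exact: nbhs_right_gt.
have : `|op_act X phi - L2_inner v (resolvent lam eps phi)| <= e%:C by near: eps.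
rewrite [`|_|](_ : _ = (Normc.normc
  (op_act X phi - L2_inner v (resolvent lam eps phi)))%:C)// lecR => Xe.
rewrite -[op_act X phi](subrK (L2_inner v (resolvent lam eps phi))).
apply: le_trans (le_normcD _ _) _; rewrite addrC lerD//.
rewrite resolvent_adjoint//.
have := L2_inner_CauchySchwarz (resolvent lam (- eps) v) phi.
rewrite !L2_normE -rmorphM lecR => /le_trans; apply.
by rewrite ler_wpM2r ?L2_rnorm_ge0// RM// oppr_eq0.
Unshelve. all: by end_near. Qed.

(** In the resolvent identity [del] stays fixed while [eps] tends to 0; then [<v, R_eps v>] tends to
    [X v = a - lam]. *)
Lemma X_op_resolvent a del : S_s a v lam -> 0 < del ->
  op_dom X (resolvent lam del v) /\
  op_act X (resolvent lam del v) =
  (0 +i* del)^-1 * (L2_inner v (resolvent lam del v) - (a - lam)%:C).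
Proof.
move=> /S_s_X_op[/X_op_cvg cX Xv] d0; apply: X_op_cvgP.
have i0 (t : R) : t != 0 -> 0 +i* t != 0 :> R[i].
  by move=> t0; rewrite eq_complex negb_and /= t0 orbT.
have c0 : (0 +i* (del - eps) : R[i]^o) @[eps --> 0^'+] --> (0 +i* del : R[i]^o).
  rewrite -[X in _ --> X]subr0.
  apply: cvg_trans (cvgB (cvg_cst (0 +i* del : R[i]^o))
    (@cvg_spectral_parameter R 0)).
  apply: near_eq_cvg; apply: nearW => eps.
  by apply/eqP; rewrite eq_complex /= subr0 !eqxx.
have c1 : ((0 +i* (del - eps))^-1 : R[i]^o) @[eps --> 0^'+] -->
    ((0 +i* del)^-1 : R[i]^o).
  by apply: cvgV c0; apply: i0; rewrite gt_eqF.
rewrite -Xv.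
apply: cvg_trans (cvgM c1 (cvgB
  (cvg_cst (L2_inner v (resolvent lam del v) : R[i]^o)) cX)).
apply: near_eq_cvg; near=> eps.
have e0 : eps != 0 by rewrite gt_eqF//; near: eps; exact: nbhs_right_gt.
(* This keeps the scalar [i (del - eps)] invertible. *)
have ed : eps < del by near: eps; exact: nbhs_right_lt.
have d0' : del != 0 by rewrite gt_eqF.
have := congr1 (L2_inner v) (resolvent_identity lam v e0 d0').
rewrite L2_innerZr -[X in _ = L2_inner _ (_ + X)]scaleN1r L2_innerDr.
rewrite L2_innerZr mulN1r => RE.
transitivity ((0 +i* (del - eps))^-1 *
  (L2_inner v (resolvent lam del v) - L2_inner v (resolvent lam eps v))) => //.
by rewrite -RE mulKf// i0// subr_eq0 gt_eqF.
Unshelve. all: by end_near. Qed.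

Lemma bounded_inv_sq_dist a : S_s a v lam -> bounded_op X -> (I < +oo)%E.
Proof.
move=> Ss [M XM].
(* The constant of [bounded_op] lies in [R[i]]; its modulus provides a real bound. *)
suff RM eps : 0 < eps -> L2_rnorm (resolvent lam eps v) <= Normc.normc M.
  by apply: le_lt_trans (integral_inv_sq_dist_le RM) _; rewrite ltry.
move=> e0; have [Xr Xre] := X_op_resolvent Ss e0.
have e0' : eps != 0 by rewrite gt_eqF.
set r := resolvent lam eps v in Xr Xre *.
(* Imaginary parts are compared in [<v, r> = i eps X r + (a - lam)]: the real term drops out and the
   factor [eps] cancels. *)
have ReX : complex.Re (op_act X r) = L2_rnorm r ^+ 2.
  have := Im_L2_inner_resolvent lam v e0'; rewrite -/r.
  have i0 : 0 +i* eps != 0 :> R[i] by rewrite eq_complex negb_and /= e0' orbT.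
  have -> : L2_inner v r = (0 +i* eps) * op_act X r + (a - lam)%:C.
    by rewrite Xre mulVKf// subrK.
  case: (op_act X r) => p q /= /eqP.
  by rewrite mul0r add0r addr0 => /eqP/(mulfI e0').
have : (Normc.normc (op_act X r)) <= Normc.normc M * L2_rnorm r.
  rewrite -lecR rmorphM.
  have := XM _ Xr; rewrite L2_normE => XMr.
  have : `|op_act X r| <= `|M * (L2_rnorm r)%:C|.
    by rewrite [leRHS]ger0_norm//; exact: le_trans (normr_ge0 _) XMr.
  by rewrite normrM -L2_normE normr_id.
move=> le1; have : L2_rnorm r ^+ 2 <= Normc.normc M * L2_rnorm r.
  rewrite -ReX; apply: le_trans le1.
  exact: le_trans (ler_norm _) (normr_Re_le_normc _).
have [->|r0] := eqVneq (L2_rnorm r) 0; first by rewrite normc_ge0.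
by rewrite expr2 ler_pM2r// lt0r r0 L2_rnorm_ge0.
Qed.

(** It remains to identify [a - lam] with the integral of [h = |v|^2 / (x - lam)]. The real part [g]
    of the regularized integrand differs from [h] by at most [eps k], where
    [k = |v|^2 / (x - lam)^2] is integrable; hence the integral of [g] tends both to that of [h] and
    to [a - lam]. *)
Lemma S_s_pp a : S_s a v lam -> (I < +oo)%E -> S_pp a v lam.
Proof.
move=> Ss Ioo; split=> //.
have vs := L2_fun_sqint v; have /sqintP[/measurable_cmodulus mv _] := vs.
have mi := measurable_inv_sub lam.
have ic2 : m.-integrable setT (EFin \o (fun x => cmodulus v x ^+ 2)).
  have := proj1 (Lfun1_integrable m _)
    (Lfun2_mul_Lfun1 (cmodulus_Lfun vs) (cmodulus_Lfun vs)).
  by apply: eq_integrable.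
pose k (x : measurableTypeR R) := cmodulus v x ^+ 2 * (x - lam)^-1 ^+ 2.
have mk : measurable_fun setT k.
  by apply: measurable_funM; apply: measurable_funX.
have k0 x : 0 <= k x by rewrite mulr_ge0 ?sqr_ge0.
have ik : m.-integrable setT (EFin \o k).
  apply/integrableP; split; first exact/measurable_EFinP.
  apply: le_lt_trans Ioo.
  have mI : measurable_fun setT (fun x : measurableTypeR R =>
      ((cmodulus v x ^+ 2)%:E * inv_sq_dist lam x)%E).
    exact: measurable_sqr_inv_sq_dist.
  apply: ge0_le_integral => //.
    by apply: measurableT_comp => //; exact/measurable_EFinP.
  move=> x _; rewrite /= ger0_norm// /k exprVn.
  by have := le_inv_sq_dist lam (cmodulus v x) 0 x; rewrite expr0n addr0.
pose h (x : measurableTypeR R) := cmodulus v x ^+ 2 / (x - lam).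
have mh : measurable_fun setT h.
  by apply: measurable_funM => //; exact: measurable_funX.
(* Domination by [|v|^2 + k] rests on [|t| <= 1 + t^2] with [t = (x - lam)^-1]. *)
have ih : m.-integrable setT (EFin \o h).
  apply: (@le_integrable _ _ _ m _ measurableT _
    (fun x => (cmodulus v x ^+ 2 + k x)%:E)).
  - exact/measurable_EFinP.
  - move=> x _; rewrite /= lee_fin [leRHS]ger0_norm ?addr_ge0 ?sqr_ge0//.
    rewrite normrM [`|_ ^+ 2|]ger0_norm ?sqr_ge0// /k.
    rewrite -[X in _ <= X + _]mulr1 -mulrDr ler_wpM2l ?sqr_ge0//.
    by rewrite ler_norml; apply/andP; split; nra.
  - exact: (integrableD measurableT ic2 ik).
suff aE : a - lam = \int[m]_x h x.
  by rewrite aE /Rintegral fineK//; exact: integrable_fin_num.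
apply/eqP; rewrite -subr_eq0 -normr_le0; apply/ler_addgt0Pr => e e0.
rewrite add0r.
pose K := \int[m]_x k x.
have K0 : 0 <= K by apply: Rintegral_ge0.
have e2 : 0 < e / 2 by rewrite divr_gt0.
have e2' : 0 < (e / 2)%:C :> R[i] by rewrite ltcR.
move/cvgrPdist_le : (Ss) => /(_ _ e2') SsE.
near (0 : R)^'+ => eps.
have eps0 : 0 < eps by near: eps; exact: nbhs_right_gt.
(* [K + 1] replaces [K] to have a positive divisor even when [K = 0]. *)
have epsK : eps * (K + 1) <= e / 2.
  rewrite -ler_pdivlMr ?ltr_wpDl//; near: eps; apply: nbhs_right_le.
  by rewrite divr_gt0// ltr_wpDl.
set F := cauchy_integral m (fun x => `|v x| ^+ 2) lam eps.
have : `|(a - lam)%:C - F| <= (e / 2)%:C by rewrite /F; near: eps.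
rewrite [`|_|](_ : _ = (Normc.normc ((a - lam)%:C - F))%:C)// lecR => F1.
have {}F1 : `|a - lam - complex.Re F| <= e / 2.
  apply: le_trans F1; apply: le_trans (normr_Re_le_normc _).
  by case: (F).
pose g (x : measurableTypeR R) :=
  cmodulus v x ^+ 2 * ((x - lam) / ((x - lam) ^+ 2 + eps ^+ 2)).
have d0 x : 0 < (x - lam) ^+ 2 + eps ^+ 2.
  by rewrite ltr_wpDl ?sqr_ge0// exprn_gt0.
have FE : complex.Re F = \int[m]_x g x.
  apply: eq_Rintegral => x _; rewrite inv_subC /g /cmodulus.
  rewrite [`|_|](_ : _ = (Normc.normc (v x))%:C)// -rmorphXn /=.
  by rewrite mul0r subr0.
have mg : measurable_fun setT g.
  apply: measurable_funM; first exact: measurable_funX.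
  have := (@cmeasurable_inv_subC R lam eps (lt0r_neq0 eps0)).1.
  by under eq_fun do rewrite inv_subC.
(* At x = lam all three terms vanish, because 0^-1 = 0. *)
have gh x : `|g x - h x| <= eps * k x.
  rewrite /g /h /k -mulrBr normrM [`|_ ^+ 2|]ger0_norm ?sqr_ge0// mulrCA.
  rewrite ler_wpM2l ?sqr_ge0//.
  have [->|t0] := eqVneq (x - lam) 0.
    by rewrite invr0 mul0r subr0 normr0 expr0n mulr0.
  have := d0 x; move: (x - lam) t0 => t t0 dt.
  (* The factors are arranged so that the last quotient has modulus at most 1, by
     [|eps t| <= t^2 + eps^2]. *)
  have -> : t / (t ^+ 2 + eps ^+ 2) - t^-1 =
      - (t^-1 ^+ 2 * (eps * ((eps * t) / (t ^+ 2 + eps ^+ 2)))).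
    by field; rewrite t0 gt_eqF.
  rewrite normrN normrM ger0_norm ?sqr_ge0// mulrC ler_wpM2r ?sqr_ge0//.
  rewrite normrM gtr0_norm// ler_piMr ?(ltW eps0)//.
  rewrite normrM normfV (gtr0_norm dt).
  rewrite ler_pdivrMr// mul1r ler_norml; apply/andP; split; nra.
have ig : m.-integrable setT (EFin \o g).
  apply: (@le_integrable _ _ _ m _ measurableT _
    (fun x => (`|h x| + eps * k x)%:E)).
  - exact/measurable_EFinP.
  - move=> x _; rewrite /= lee_fin [leRHS]ger0_norm; last first.
      by rewrite addr_ge0// mulr_ge0// ltW.
    rewrite -[g x](subrK (h x)) addrC; apply: le_trans (ler_normD _ _) _.
    by rewrite lerD2l.
  - exact: (integrableD measurableT (integrable_abse ih)
      (integrableZl measurableT eps ik)).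
have F2 : `|complex.Re F - \int[m]_x h x| <= e / 2.
  apply: le_trans epsK; rewrite FE -RintegralB//.
  have igh : m.-integrable setT (EFin \o (fun x => g x - h x)).
    exact: (integrableB measurableT ig ih).
  apply: le_trans (le_normr_Rintegral measurableT igh) _.
  apply: (@le_trans _ _ (\int[m]_x (eps * k x))).
    apply: le_Rintegral => //; first exact: (integrable_abse igh).
    exact: (integrableZl measurableT eps ik).
  by rewrite RintegralZl// ler_wpM2l ?(ltW eps0)// lerDl.
have := ler_normD (a - lam - complex.Re F) (complex.Re F - \int[m]_x h x).
rewrite addrA subrK => /le_trans; apply.
by rewrite [e]splitr lerD.
Unshelve. all: by end_near. Qed.

End boundedness.

Theorem theorem4p3 (R : realType) (m : probability (measurableTypeR R) R)
    (hm : compactly_supported m) (a1 : R) (v : L2 m)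
    (hv : cyclic_vector (@mulX R m) v) (lam : R) (hlam : S_s a1 v lam) :
  let A0 : L2 m -> L2 m := @mulX R m in
  let A1 : R[i]^o -> R[i]^o := fun c => a1%:C * c in
  let V : R[i]^o -> L2 m := fun c => c *: v in
  let Vadj : L2 m -> R[i]^o := fun x => L2_inner v x in
  [/\ strong_riccati_solution A0 A1 V Vadj (X_op v lam),
      S_pp a1 v lam -> bounded_op (X_op v lam) &
      S_sc a1 v lam -> ~ closable (X_op v lam)].
Proof.
split.
- exact: X_op_strong_solution.
- by case=> _; exact: X_op_bounded.
(* By contraposition: closable implies bounded, bounded implies that the integral is finite, and
   this places [lam] in [S_pp]. *)
- move=> [_ nSpp] cl; apply: nSpp; apply: (S_s_pp hlam).
  apply: (bounded_inv_sq_dist hlam).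
  exact: closable_bounded (X_op_linear hlam) cl.
Qed.
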